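(* Let $X$ be a space and let $\mathfrak{P}$ be a closed hereditary topological property preserved under finite closed sums. Then $$C^{\mathfrak P}_{00}(X)=\{f\in C_B(X):\mathrm{supp}(f)\text{ has a closed neighborhood in }X\text{ with }\mathfrak{P}\},$$ and in particular, $$C^{\mathfrak P}_{00}(X)=\{f\in C_B(X):\mathrm{supp}(f)\text{ has a neighborhood in }X\text{ with }\mathfrak{P}\},$$ if $X$ is normal. Furthermore: (1) $C^{\mathfrak P}_{00}(X)$ is an ideal in $C_B(X)$. (2) Let $X$ be completely regular. Then $C^{\mathfrak P}_{00}(X)$ is non-vanishing if and only if $X$ is locally-$\mathfrak{P}$. (3) Let $X$ be completely regular and locally-$\mathfrak{P}$. Then $C^{\mathfrak P}_{00}(X)$ is unital if and only if $X$ has $\mathfrak{P}$. (4) Let $X$ be normal and locally-$\mathfrak{P}$. Then $C^{\mathfrak P}_{00}(X)$ is an ideal of $C_B(X)$ isometrically isomorphic (as a normed algebra) to $C_{00}(Y)$ for some unique (up to homeomorphism) locally compact space $Y$, namely, for $Y=\lambda_{\mathfrak P}X$. Furthermore, $X$ is contained in $Y$ as a dense subspace, and the following are equivalent: $C^{\mathfrak P}_{00}(X)$ is unital; $X$ has $\mathfrak{P}$; $Y$ is compact.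
   Context: Completely regular, compact and locally compact spaces are assumed to be Hausdorff, and normal spaces are Hausdorff as well (hence completely regular). $C_B(X)$ is the normed algebra of continuous bounded $f:X\to\mathbb{C}$ with the supremum norm. For continuous $f:X\to\mathbb{C}$, $\mathrm{coz}(f)=X\setminus f^{-1}(0)$ and $\mathrm{supp}(f)=\mathrm{cl}_X\mathrm{coz}(f)$; $\mathrm{Coz}(X)$ is the set of all cozero-sets $\mathrm{coz}(f)$ of $X$. $C_{00}(Y)$ is the set of $f\in C_B(Y)$ with compact support. $\beta X$ is the Stone–Čech compactification of $X$. A neighborhood of $A\subseteq X$ in $X$ is a set $U\subseteq X$ with $A\subseteq\mathrm{int}_XU$. A topological property $\mathfrak{P}$ is a homeomorphism-invariant property of spaces, always assumed non-empty (some space has $\mathfrak{P}$). $\mathfrak{P}$ is closed hereditary if any closed subspace of a space having $\mathfrak{P}$ also has $\mathfrak{P}$; it is preserved under finite closed sums if any space which is a finite union of closed subspaces each having $\mathfrak{P}$ also has $\mathfrak{P}$. A space $X$ is locally-$\mathfrak{P}$ if each $x\in X$ has a neighborhood in $X$ with $\mathfrak{P}$. Let $\mathfrak{I}_{\mathfrak P}=\{A\subseteq X:\mathrm{cl}_XA\text{ has }\mathfrak{P}\}$, and call its elements null; when $\mathfrak{P}$ is closed hereditary and preserved under finite closed sums, this is an ideal of sets (closed under subsets and finite unions). Define $$C^{\mathfrak P}_{00}(X)=\{f\in C_B(X):\mathrm{supp}(f)\text{ has a null neighborhood in }X\},$$ and, for $X$ completely regular, $$\lambda_{\mathfrak P}X=\bigcup\{\mathrm{int}_{\beta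 X}\mathrm{cl}_{\beta X}C:C\in\mathrm{Coz}(X)\text{ and }\mathrm{cl}_XC\text{ has a null neighborhood in }X\}\subseteq\beta X.$$ An ideal $H$ of $C_B(X)$ is non-vanishing if for every $x\in X$ there is $h\in H$ with $h(x)\neq0$; it is unital if, as an algebra, it has a multiplicative identity. *)

(* Defs.v *)
From HB Require Import structures.
From mathcomp Require Import all_boot all_order all_algebra.
From mathcomp Require Import all_classical all_reals all_analysis.
From mathcomp Require Import complex.
Set Implicit Arguments.
Unset Strict Implicit.
Unset Printing Implicit Defensive.
Import Order.TTheory GRing.Theory Num.Theory.
Import numFieldNormedType.Exports.
Local Open Scope classical_set_scope.
Local Open Scope ring_scope.

(* The numClosedFieldType packaging makes [numFieldNormedType] equip the
   complex numbers over R with the topology of the modulus. *)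
Definition Cplx (R : realType) : numClosedFieldType := R[i].

(* [`|z|] is a complex number in MathComp; this is the same modulus with values
   in R. *)
Definition cmod (R : realType) (z : Cplx R) : R := Normc.normc z.

Section Spaces.

Definition homeomorphic (X Y : topologicalType) : Prop :=
  exists (f : X -> Y) (g : Y -> X),
    [/\ continuous f, continuous g, cancel f g & cancel g f].

Definition topological_embedding (X Y : topologicalType) (f : X -> Y) : Prop :=
  injective f /\
  (forall U : set X, open U <-> exists2 V : set Y, open V & f @^-1` V = U).

(* Normal, completely regular, compact and locally compact spaces are Hausdorff
   by convention. *)
Definition normal_hausdorff (X : topologicalType) : Prop :=
  normal_space X /\ hausdorff_space X.

Definition completely_regular_hausdorff (X : topologicalType) : Prop :=
  completely_regular_space X /\ hausdorff_space X.

Definition compact_hausdorff (X : topologicalType) : Prop :=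
  compact [set: X] /\ hausdorff_space X.

Definition locally_compact_hausdorff (X : topologicalType) : Prop :=
  locally_compact [set: X] /\ hausdorff_space X.

Definition neighborhood (X : topologicalType) (A U : set X) : Prop :=
  A `<=` U°.

End Spaces.

(* A property is a predicate on spaces.  A subset [A : set X] has the property
   [P] when [P A] holds, where [A] is coerced to the type [set_type A] with the
   subspace topology. *)
Section TopologicalProperty.
Implicit Type P : topologicalType -> Prop.

Definition topological_property P : Prop :=
  (exists X : topologicalType, P X) /\
  (forall X Y : topologicalType, homeomorphic X Y -> P X -> P Y).

Definition closed_hereditary P : Prop :=
  forall (X : topologicalType) (A : set X), P X -> closed A -> P A.

Definition preserved_finite_closed_sums P : Prop :=
  forall (X : topologicalType) (n : nat) (F : 'I_n -> set X),
    (forall i, closed (F i)) -> (forall i, P (F i)) ->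
    \bigcup_i F i = [set: X] -> P X.

Definition locally_prop P (X : topologicalType) : Prop :=
  forall x : X, exists2 U : set X, neighborhood [set x] U & P U.

Definition null_set P (X : topologicalType) (A : set X) : Prop :=
  P (closure A).

Definition has_null_neighborhood P (X : topologicalType) (A : set X) : Prop :=
  exists2 U : set X, neighborhood A U & null_set P U.

End TopologicalProperty.

(* Algebras of functions are subsets of the algebra [X -> Cplx R] of all
   functions, whose operations are pointwise. *)
Section FunctionAlgebras.
Variables (R : realType) (X : topologicalType).
Implicit Types (f g h : X -> Cplx R) (H : set (X -> Cplx R)).

Definition coz f : set X := [set x | f x != 0].

Definition supp f : set X := closure (coz f).

Definition Coz : set (set X) :=
  [set C | exists2 f : X -> Cplx R, continuous f & coz f = C].

Definition CB : set (X -> Cplx R) :=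
  [set f : X -> Cplx R | continuous f /\ exists M : R, forall x, cmod (f x) <= M].

(* When X is empty, [sup set0 = 0] is the norm of the only function. *)
Definition supnorm f : R := sup (range (fun x => cmod (f x))).

Definition C00 : set (X -> Cplx R) := [set f | CB f /\ compact (supp f)].

Definition C00P (P : topologicalType -> Prop) : set (X -> Cplx R) :=
  [set f | CB f /\ has_null_neighborhood P (supp f)].

Definition is_ideal H : Prop :=
  [/\ H `<=` CB, H 0,
      forall f g, H f -> H g -> H (f + g),
      forall (a : Cplx R) f, H f -> H (a *: f)
    & forall f h, CB f -> H h -> H (f * h) /\ H (h * f)].

Definition non_vanishing H : Prop :=
  forall x : X, exists2 h, H h & h x != 0.

Definition unital H : Prop :=
  exists2 u, H u & forall h, H h -> u * h = h /\ h * u = h.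

End FunctionAlgebras.

(* Only the values of [phi] on [H] matter. *)
Definition isometrically_isomorphic (R : realType) (X Y : topologicalType)
    (H : set (X -> Cplx R)) (K : set (Y -> Cplx R)) : Prop :=
  exists phi : (X -> Cplx R) -> (Y -> Cplx R),
    [/\ set_bij H K phi,
        forall f g, H f -> H g -> phi (f + g) = phi f + phi g,
        forall (a : Cplx R) f, H f -> phi (a *: f) = a *: phi f,
        forall f g, H f -> H g -> phi (f * g) = phi f * phi g
      & forall f, H f -> supnorm (phi f) = supnorm f].

(* The Stone-Cech compactification of X is the closure of the image of X in the
   cube indexed by all the continuous functions from X to [0, 1]. *)
Section StoneCech.
Variables (R : realType) (X : topologicalType).

Definition unit_functions : set (X -> R) :=
  [set f : X -> R | continuous f /\ forall x, 0 <= f x <= 1].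

Definition cube : topologicalType :=
  prod_topology (fun _ : unit_functions => R : topologicalType).

Definition evaluation (x : X) : cube := fun f => set_val f x.

Definition stone_cech : topologicalType := set_type (closure (range evaluation)).

Definition to_stone_cech (x : X) : stone_cech :=
  SigSub (mem_set (subset_closure (imageT evaluation x))).

Definition lambda (P : topologicalType -> Prop) : set stone_cech :=
  \bigcup_(C in [set C : set X | Coz R C /\ has_null_neighborhood P (closure C)])
    (closure (to_stone_cech @` C))°.

Definition lambda_space (P : topologicalType -> Prop) : topologicalType :=
  set_type (lambda P).

End StoneCech.

Arguments unit_functions : clear implicits.

Section StoneCechTheory.
Variables (R : realType) (X : topologicalType).

Lemma cube_proj_continuous (f : unit_functions R X) :
  continuous (fun p : cube R X => p f).
Proof.
exact: (@proj_continuous _ (fun _ : unit_functions R X => R : topologicalType) f).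
Qed.

Lemma stone_cech_val_continuous : continuous (set_val : stone_cech R X -> cube R X).
Proof. exact: (@initial_continuous _ _ (set_val : stone_cech R X -> cube R X)). Qed.

Lemma stone_cech_hausdorff : hausdorff_space (stone_cech R X).
Proof.
have hc : hausdorff_space (cube R X).
  apply: (@hausdorff_product _ (fun _ : unit_functions R X => R : topologicalType)) => f.
  exact: (@Rhausdorff R).
move=> p q pq; apply/val_inj/hc => U V nU nV.
have [z [Uz Vz]] := pq _ _
  (stone_cech_val_continuous (x := p) nU) (stone_cech_val_continuous (x := q) nV).
by exists (set_val z).
Qed.

Lemma evaluation_continuous : continuous (@evaluation R X).
Proof.
move=> x; apply/cvg_sup => f U [_ [[W oW <-] Wx] WU].
apply: filterS WU _; have [cf _] := set_valP f.
by apply: (cf x); exact: open_nbhs_nbhs.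
Qed.

Lemma stone_cech_compact : compact [set: stone_cech R X].
Proof.
pose K := [set p : cube R X | forall f, p f \in `[0, 1]%R].
have cK : compact K.
  apply: (@tychonoff _ (fun _ : unit_functions R X => R : topologicalType) (fun=> [set` `[0, 1]%R])) => f.
  exact: segment_compact.
have sK : closure (range (@evaluation R X)) `<=` K.
  move=> p clp f; have : closed [set` `[(0:R), 1]%R] by exact: itv_closed.
  change (closed [set` `[(0:R), 1]%R] -> [set` `[(0:R), 1]%R] (p f)) => clI.
  apply: clI.
  move=> B /(@cube_proj_continuous f p _)/clp [_ [[x _ <-] Bx]].
  by exists (set_val f x); split => //=; rewrite in_itv /=; have [_] := set_valP f; exact.
have cc : compact (closure (range (@evaluation R X))).
  exact: subclosed_compact (@closed_closure _ _) cK sK.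
move=> F PF _.
have Fcl : (set_val @ F) (closure (range (@evaluation R X))).
  by apply: (@filterE _ F) => q; exact: (set_valP q).
have [p [clp Fp]] := cc (set_val @ F) _ Fcl.
exists (SigSub (mem_set clp)); split => // A B FA [_ [[W oW <-] Wp] WB].
have FA' : (set_val @ F) (set_val @` A) by apply: (@filterS _ F _ A) FA => q Aq; exists q.
have [_ [[q Aq <-] Wq]] := Fp _ W FA' (open_nbhs_nbhs (conj oW Wp)).
by exists q; split => //; exact: WB.
Qed.

Lemma to_stone_cech_continuous : continuous (@to_stone_cech R X).
Proof.
apply/continuousP => _ [V oV <-].
have := evaluation_continuous => /continuousP /(_ V oV); exact.
Qed.

Lemma to_stone_cech_dense : dense (range (@to_stone_cech R X)).
Proof.
move=> _ /[swap] -[W oW <-] [p Up].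
have [_ [[x _ <-] Wx]] := set_valP p W (open_nbhs_nbhs (conj oW Up)).
by exists (to_stone_cech R x); split => //; exists x.
Qed.

Lemma stone_cech_extension (f : X -> R) :
  continuous f -> (forall x, 0 <= f x <= 1) ->
  exists2 g : stone_cech R X -> R, continuous g & g \o (@to_stone_cech R X) = f.
Proof.
move=> cf f01; pose i : unit_functions R X := SigSub (mem_set (conj cf f01)).
exists (fun p => set_val p i) => // p U /(@cube_proj_continuous i (set_val p) _) nU.
exact: (stone_cech_val_continuous (x := p) nU).
Qed.

End StoneCechTheory.

(* Main.v *)
Require Import Defs.
From HB Require Import structures.
From mathcomp Require Import all_boot all_order all_algebra.
From mathcomp Require Import all_classical all_reals all_analysis.
From mathcomp Require Import complex.
Set Implicit Arguments.
Unset Strict Implicit.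
Unset Printing Implicit Defensive.
Import Order.TTheory GRing.Theory Num.Theory.
Import numFieldNormedType.Exports.
Local Open Scope classical_set_scope.
Local Open Scope ring_scope.

(* Write Y for lambda_P X, an open subset of beta X which contains X because X is
   locally-P.  A bounded f on X extends to beta X.  If supp f has a null
   neighborhood, a Urysohn function that is 1 on supp f and 0 off this
   neighborhood cuts out a cozero-set showing that the support of the extension
   lies in Y; so the extension restricted to Y has compact support.  Conversely, a
   compact subset of Y is covered by finitely many of the open sets defining Y, so
   its trace on X has a null neighborhood.  Hence restriction to the dense
   subspace X identifies C_00(Y) with C_00^P(X).

   Y is unique because every character chi of C_00(Y) is the evaluation at a
   point.  Otherwise, for every f, compactness of supp f yields h = sum |g_i|^2 in
   ker chi without zeros on supp f, so that f = (f / h) h is in ker chi.  No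
   completeness or norm enters, so the algebra structure already determines Y. *)

(** * The real-valued modulus on the complex numbers *)

Section ComplexNumbers.
Variable R : realType.
Implicit Types z w : Cplx R.

Lemma cmodE z : `|z| = real_complex R (cmod z).
Proof. by []. Qed.

Lemma ltr_cmod z (e : R) : (`|z| < real_complex R e) = (cmod z < e).
Proof. by rewrite cmodE ltcR. Qed.

Lemma cmod_ge0 z : 0 <= cmod z.
Proof. by case: z => a b; exact: sqrtr_ge0. Qed.

Lemma cmod0 : cmod (0 : Cplx R) = 0.
Proof. exact: Normc.normc0. Qed.

Lemma ler_cmodD z w : cmod (z + w) <= cmod z + cmod w.
Proof. by rewrite -lecR rmorphD /= -!cmodE; exact: ler_normD. Qed.

Lemma cmodN z : cmod (- z) = cmod z.
Proof. by apply: complexI; rewrite -!cmodE normrN. Qed.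

Lemma cmodM z w : cmod (z * w) = cmod z * cmod w.
Proof. exact: Normc.normcM. Qed.

Lemma ler_Re_cmod z : `|complex.Re z| <= cmod z.
Proof. by rewrite -lecR; exact: normc_ge_Re. Qed.

Lemma ler_Im_cmod z : `|complex.Im z| <= cmod z.
Proof.
case: z => a b /=; rewrite -sqrtr_sqr; apply: ler_wsqrtr.
by rewrite lerDr sqr_ge0.
Qed.

(** The norm of [Cplx R] is complex-valued, so radii of balls are complex numbers; a positive one
    has zero imaginary part, which reduces everything to real radii. *)
Lemma cvg_cmodP (T : Type) (F : set_system T) {FF : Filter F}
    (f : T -> Cplx R) (z : Cplx R) :
  f @ F --> z <-> forall e : R, 0 < e -> \forall t \near F, cmod (z - f t) < e.
Proof.
split=> [/cvgrPdist_lt fz e e0|fz].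
  have e0' : 0 < real_complex R e :> Cplx R by rewrite ltcR.
  by apply: filterS (fz _ e0') => t /=; rewrite ltr_cmod.
apply/cvgrPdist_lt => -[a b]; rewrite ltcE /= => /andP[/eqP -> a0].
by apply: filterS (fz _ a0) => t; rewrite ltr_cmod.
Qed.

Lemma near_cmod z (e : R) : 0 < e -> \forall w \near nbhs z, cmod (z - w) < e.
Proof.
by move=> e0; apply: (cvg_cmodP (FF := nbhs_filter z) id z).1 => //; exact: cvg_id.
Qed.

(** Serves [Re], [Im] and the modulus at once, all three being 1-Lipschitz. *)
Lemma continuous_real_part (u : Cplx R -> R) :
  (forall z w, `|u z - u w| <= cmod (z - w)) -> continuous u.
Proof.
move=> lip z; apply/(cvgrPdist_lt (FF := nbhs_filter z)) => e e0.
by apply: filterS (near_cmod z e0) => w; exact: le_lt_trans.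
Qed.

Lemma Re_continuous : continuous (@complex.Re R : Cplx R -> R).
Proof.
apply: continuous_real_part => z w.
have -> : complex.Re z - complex.Re w = complex.Re (z - w) by case: z w => ? ? [].
exact: ler_Re_cmod.
Qed.

Lemma Im_continuous : continuous (@complex.Im R : Cplx R -> R).
Proof.
apply: continuous_real_part => z w.
have -> : complex.Im z - complex.Im w = complex.Im (z - w) by case: z w => ? ? [].
exact: ler_Im_cmod.
Qed.

Lemma cmod_continuous : continuous (@cmod R).
Proof.
have t z w : cmod z - cmod w <= cmod (z - w).
  by rewrite lerBlDr -{1}(subrK w z) ler_cmodD.
apply: continuous_real_part => z w; rewrite ler_norml t andbT.
by rewrite lerNl opprB -[cmod (z - w)]cmodN opprB t.
Qed.

Lemma real_complex_continuous : continuous (real_complex R : R -> Cplx R).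
Proof.
move=> a; apply/cvg_cmodP => e e0.
have /cvgrPdist_lt /(_ _ e0) h : id x @[x --> a] --> a by exact: cvg_id.
apply: filterS h => b; rewrite /cmod /= subr0 expr0n addr0 sqrtr_sqr; exact.
Qed.

Lemma conj_continuous : continuous (@Num.conj (Cplx R)).
Proof.
move=> z; apply/(cvg_cmodP (FF := nbhs_filter z)) => e e0.
apply: filterS (near_cmod z e0) => w.
by rewrite -!ltr_cmod -rmorphB norm_conjC.
Qed.

End ComplexNumbers.

(** * Subspaces and compactness *)

Section Subspaces.
Implicit Types X Y : topologicalType.

Lemma continuous_into_subspace X Y (A : set Y) (f : X -> A) :
  continuous (set_val \o f) -> continuous f.
Proof.
move=> /continuousP cf; apply/continuousP => _ [V oV <-].
exact: cf.
Qed.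

Lemma subspace_val_continuous X (A : set X) : continuous (set_val : A -> X).
Proof. exact: (@initial_continuous _ _ (set_val : A -> X)). Qed.

Lemma preimage_closed_continuous X Y (f : X -> Y) (A : set Y) :
  continuous f -> closed A -> closed (f @^-1` A).
Proof. by move=> /continuous_closedP; apply. Qed.

Lemma set_type_hausdorff X (A : set X) :
  hausdorff_space X -> hausdorff_space (A : topologicalType).
Proof.
move=> hX p q pq; apply/val_inj/hX => U V nU nV.
have [z [Uz Vz]] := pq _ _
  (subspace_val_continuous (x := p) nU) (subspace_val_continuous (x := q) nV).
by exists (set_val z).
Qed.

(** [[set: X]] coerces to a type distinct from [X], so [P] passes between the two only along a
    homeomorphism. *)
Lemma homeomorphic_setT X : homeomorphic ([set: X] : topologicalType) X.
Proof.
exists set_val, (fun x => SigSub (mem_set (I : [set: X] x))); split=> //.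
- exact: subspace_val_continuous.
- by apply: continuous_into_subspace => x; exact: cvg_id.
- by move=> x; exact: val_inj.
Qed.

Lemma homeomorphic_sym X Y : homeomorphic X Y -> homeomorphic Y X.
Proof. by case=> f [g [cf cg fK gK]]; exists g, f. Qed.

(** Closed heredity concerns subsets of a whole space. To use it for [A] inside [W], one works in
    the subspace [W] and returns to [A] along this homeomorphism. *)
Lemma homeomorphic_nested X (A W : set X) : A `<=` W ->
  homeomorphic ((set_val @^-1` A : set W) : topologicalType)
               (A : topologicalType).
Proof.
move=> AW.
pose f (p : (set_val @^-1` A : set W)) : A :=
  SigSub (mem_set (set_valP p : A (set_val (set_val p)))).
pose g (q : A) : (set_val @^-1` A : set W) :=
  let w : W := SigSub (mem_set (AW _ (set_valP q))) in
  SigSub (mem_set (set_valP q : (set_val @^-1` A) w)).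
exists f, g; split.
- apply: continuous_into_subspace => p.
  apply: (@continuous_comp _ _ _ set_val set_val); exact: subspace_val_continuous.
- do 2!apply: continuous_into_subspace.
  exact: subspace_val_continuous.
- by move=> p; do 2!apply: val_inj.
- by move=> q; apply: val_inj.
Qed.

(** A filter on [A] is pushed forward to [X]; its cluster point lies in [K], hence in [A], where it
    is again a cluster point. *)
Lemma compact_subspace X (A K : set X) : compact K -> K `<=` A ->
  compact (set_val @^-1` K : set A).
Proof.
move=> cK KA F PF FK.
have [p [Kp Fp]] := cK (set_val @ F) _ FK.
exists (SigSub (mem_set (KA _ Kp))); split => // B C FB [_ [[W oW <-] Wp] WC].
have FB' : (set_val @ F) (set_val @` B).
  by apply: (@filterS _ F _ B) FB => q Bq; exists q.
have [_ [[q Bq <-] Wq]] := Fp _ W FB' (open_nbhs_nbhs (conj oW Wp)).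
by exists q; split => //; exact: WC.
Qed.

Lemma compact_image X Y (f : X -> Y) (K : set X) :
  continuous f -> compact K -> compact (f @` K).
Proof. by move=> cf; apply: continuous_compact; exact: continuous_subspaceT. Qed.

(* The sets whose relative complement in K satisfies Q would otherwise form a
   proper filter without cluster point in K. *)
Lemma compact_ind X (Q : set X -> Prop) (K : set X) :
  Q set0 -> (forall A B, A `<=` B -> Q B -> Q A) ->
  (forall A B, Q A -> Q B -> Q (A `|` B)) ->
  (forall x, K x -> exists2 V, nbhs x V & Q V) -> compact K -> Q K.
Proof.
move=> Q0 QS QU Qloc cK; apply: contrapT => nQK.
pose F : set_system X := [set A | Q (K `\` A)].
have PF : ProperFilter F.
  split=> [|]; first by rewrite /F /= setD0.
  split=> [|A B FA FB|A B AB]; rewrite /F /=.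
  - by rewrite setDT.
  - by rewrite setDIr; exact: QU.
  - by apply: QS => x [Kx nBx]; split => // /AB.
have FK : F K by rewrite /F /= setDv.
have [x [Kx Fx]] := cK F PF FK.
have [V nV QV] := Qloc x Kx.
have FV : F (~` V) by apply: QS QV; rewrite setDE setCK; exact: subIsetr.
by have [y [+ Vy]] := Fx _ _ FV nV; exact.
Qed.

Lemma dense_inter_closure X (D U : set X) :
  dense D -> open U -> U `<=` closure (U `&` D).
Proof.
move=> dD oU x Ux B nB.
have [|y [[By Uy] Dy]] := dD (B° `&` U) _ (openI (@open_interior _ B) oU).
  by exists x.
by exists y; split=> //; exact: interior_subset.
Qed.

Lemma dense_eq X Y (f g : X -> Y) (D : set X) : hausdorff_space Y -> dense D ->
  continuous f -> continuous g -> (forall x, D x -> f x = g x) -> f = g.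
Proof.
move=> hY dD cf cg fg; apply/funext => x; apply: hY => U V nU nV.
have nUV : nbhs x (f @^-1` U `&` g @^-1` V).
  by apply: filterI; [exact: cf | exact: cg].
have [|y [/interior_subset[/= Uy Vy] Dy]] :=
  dD (f @^-1` U `&` g @^-1` V)° _ (@open_interior _ _).
  by exists x.
by exists (f y); split=> //; rewrite fg.
Qed.

End Subspaces.

(** * Bump functions from complete regularity and normality *)

Section CompletelyRegular.
Variables (R : realType) (X : topologicalType).

Lemma unit_continuous (u : unit_functions R X) : continuous (set_val u : X -> R).
Proof. exact: (set_valP u).1. Qed.

Lemma unit_bounds (u : unit_functions R X) x : 0 <= (set_val u : X -> R) x <= 1.
Proof. exact: (set_valP u).2. Qed.

Lemma normal_completely_regular_hausdorff :
  normal_hausdorff X -> completely_regular_hausdorff X.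
Proof.
move=> [nX hX]; split=> //; apply: (normal_completely_regular (R := R)) => //.
exact: hausdorff_accessible.
Qed.

Lemma completely_regular_bump (x : X) (U : set X) :
  completely_regular_space X -> nbhs x U ->
  exists f : unit_functions R X, set_val f x = 1 /\
    forall y, ~ U y -> set_val f y = 0.
Proof.
move=> crX nU.
have /(uniform_separatorP (R := R)) [f [cf f01 fx fU]] :
    uniform_separator [set x] (~` U°).
  apply: crX; first exact/open_closedC/open_interior.
  by apply.
(* The separating function is 0 at [x] and 1 off [U°], so its reflection is the bump. *)
have i : unit_functions R X (fun y => 1 - f y).
  split=> [y|y]; first by apply: cvgB; [exact: cvg_cst | exact: cf].
  have /f01 : range f (f y) by exists y.
  by rewrite /= in_itv /= => /andP[? ?]; rewrite subr_ge0 lerBlDr lerDl; apply/andP.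
exists (SigSub (mem_set i)); rewrite set_valE; split=> [|y nUy] /=.
  have -> : f x = 0 by apply: fx; exists x.
  by rewrite subr0.
have -> : f y = 1 by apply: fU; exists y => // /interior_subset.
by rewrite subrr.
Qed.

(** Urysohn's lemma for the complement of [U°] and [A], in this order so that the value 1 falls on
    [A]. *)
Lemma normal_bump (A U : set X) : normal_space X -> closed A -> A `<=` U° ->
  exists f : unit_functions R X, (forall y, A y -> set_val f y = 1) /\
    forall y, ~ U y -> set_val f y = 0.
Proof.
move=> nX cA AU.
have /(uniform_separatorP (R := R)) [f [cf f01 fU fA]] :
    uniform_separator (~` U°) A.
  move/(@normal_separatorP R X): nX; apply=> //.
    exact/open_closedC/open_interior.
  by apply/disjoints_subset/subsetC.
have i : unit_functions R X f.
  by split=> // y; have /f01 : range f (f y) by exists y.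
exists (SigSub (mem_set i)); rewrite set_valE; split=> [y Ay|y nUy] /=.
  by have /fA : (f @` A) (f y) by exists y.
by have /fU : (f @` (~` U°)) (f y) by exists y => // /interior_subset.
Qed.

End CompletelyRegular.

(** * Null sets and null supports *)

Section NullSets.
Local Notation null_set := Defs.null_set.
Variable P : topologicalType -> Prop.
Hypothesis hP : topological_property P.
Hypothesis hclosed : closed_hereditary P.
Hypothesis hsums : preserved_finite_closed_sums P.
Variable X : topologicalType.
Implicit Types A B U V W : set X.

Lemma prop_homeomorphic (Y Z : topologicalType) : homeomorphic Y Z -> P Y -> P Z.
Proof. exact: hP.2. Qed.

Lemma prop_setT : P [set: X] <-> P X.
Proof.
split; apply: prop_homeomorphic; last apply: homeomorphic_sym;
  exact: homeomorphic_setT.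
Qed.

Lemma prop_closed_subset A W : A `<=` W -> closed A -> P W -> P A.
Proof.
move=> AW cA PW; apply: prop_homeomorphic (homeomorphic_nested AW) _.
apply: hclosed => //.
by apply: preimage_closed_continuous => //; exact: subspace_val_continuous.
Qed.

(** The empty space is the union of a family of no closed subspaces, which is the case [n = 0] of
    [hsums]. *)
Lemma prop_set0 : P (set0 : set X).
Proof.
apply: (hsums (n := 0) (F := fun=> set0)) => [[]//|[]//|].
by apply/seteqP; split=> // -[x xs]; have := set_mem xs.
Qed.

(** [hsums] is applied in the subspace on the union, where the traces of [A] and [B] are closed and
    homeomorphic to [A] and [B]. *)
Lemma prop_closedU A B : closed A -> closed B -> P A -> P B -> P (A `|` B).
Proof.
move=> cA cB PA PB.
pose G (i : 'I_2) : set X := if i == ord0 then A else B.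
have GAB i : G i `<=` A `|` B by rewrite /G; case: ifP => _ x ?; [left|right].
apply: (hsums (n := 2) (F := fun i => set_val @^-1` G i)) => [i|i|].
- apply: preimage_closed_continuous; first exact: subspace_val_continuous.
  by rewrite /G; case: ifP.
- apply: prop_homeomorphic (homeomorphic_sym (homeomorphic_nested (GAB i))) _.
  by rewrite /G; case: ifP.
- apply/seteqP; split=> // p _; have [Ap|Bp] := set_valP p.
    by exists ord0.
  by exists ord_max.
Qed.

Lemma null_setU A B : null_set P A -> null_set P B -> null_set P (A `|` B).
Proof.
by move=> nA nB; rewrite /null_set closureU;
  apply: prop_closedU => //; exact: closed_closure.
Qed.

Lemma has_null_neighborhood0 : has_null_neighborhood P (set0 : set X).
Proof. by exists set0 => //; rewrite /null_set closure0; exact: prop_set0. Qed.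

Lemma has_null_neighborhoodS A B :
  A `<=` B -> has_null_neighborhood P B -> has_null_neighborhood P A.
Proof. by move=> AB [U BU nU]; exists U => //; exact: subset_trans BU. Qed.

Lemma has_null_neighborhoodU A B : has_null_neighborhood P A ->
  has_null_neighborhood P B -> has_null_neighborhood P (A `|` B).
Proof.
move=> [U AU nU] [V BV nV]; exists (U `|` V); last exact: null_setU.
move=> x [/AU|/BV]; apply: interiorS; [exact: subsetUl|exact: subsetUr].
Qed.

Lemma has_null_neighborhoodT : has_null_neighborhood P [set: X] <-> P X.
Proof.
split=> [[U XU]|PX].
  have -> : U = [set: X] by apply/seteqP; split=> // x /XU /interior_subset.
  by rewrite /null_set closureT => /prop_setT.
exists [set: X]; first by rewrite /neighborhood interiorT.
by rewrite /null_set closureT; exact/prop_setT.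
Qed.

Lemma has_null_neighborhood_closedP A : has_null_neighborhood P A <->
  exists U, [/\ closed U, neighborhood A U & P U].
Proof.
split=> [[U AU nU]|[U [cU AU PU]]].
  exists (closure U); split=> //; first exact: closed_closure.
  by apply: subset_trans AU _; apply: interiorS; exact: subset_closure.
by exists U => //; rewrite /null_set -(closure_id U).1.
Qed.

Lemma has_null_neighborhood_closed_subset A V U : neighborhood A V -> closed V ->
  V `<=` U -> P U -> has_null_neighborhood P A.
Proof.
move=> AV cV VU PU; apply/has_null_neighborhood_closedP; exists V; split => //.
exact: prop_closed_subset PU.
Qed.

Lemma closed_superlevel (R : realType) (f : X -> R) (a : R) :
  continuous f -> closed [set x | a <= f x].
Proof.
by move=> cf; apply: (preimage_closed_continuous (A := [set y | a <= y])).
Qed.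

Lemma open_superlevel (R : realType) (f : X -> R) (a : R) :
  continuous f -> open [set x | a < f x].
Proof.
by move=> /continuousP cf; apply: (cf [set y | a < y]); exact: open_gt.
Qed.

(** The closed set where [b <= f] is a neighborhood of the one where [a <= f], through the open set
    where [b < f]; it has [P] as a closed subset of [U], which itself may fail to be closed. *)
Lemma superlevel_null_neighborhood (R : realType) (f : X -> R) (a b : R) U :
  continuous f -> b < a -> [set x | b <= f x] `<=` U -> P U ->
  has_null_neighborhood P [set x | a <= f x].
Proof.
move=> cf ba bU PU.
apply: has_null_neighborhood_closed_subset bU PU; last exact: closed_superlevel.
have := open_superlevel b cf; rewrite openE => ob x ax.
apply: (interiorS (A := [set x | b < f x])) => [y /ltW//|].
by apply: ob; exact: lt_le_trans ax.
Qed.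

End NullSets.

(** * Bounded functions, cozero-sets and supports *)

Section FunctionSpaces.
Variables (R : realType) (X : topologicalType).
Implicit Types f g h : X -> Cplx R.

Lemma CB0 : CB (0 : X -> Cplx R).
Proof. by split=> [x|]; [exact: cvg_cst|exists 0 => x; rewrite cmod0]. Qed.

Lemma CBD f g : CB f -> CB g -> CB (f + g).
Proof.
move=> [cf [M fM]] [cg [N gN]]; split=> [x|].
  by apply: cvgD; [exact: cf|exact: cg].
by exists (M + N) => x; apply: le_trans (ler_cmodD _ _) (lerD _ _).
Qed.

Lemma CBM f g : CB f -> CB g -> CB (f * g).
Proof.
move=> [cf [M fM]] [cg [N gN]]; split=> [x|].
  by apply: cvgM; [exact: cf|exact: cg].
by exists (M * N) => x; rewrite cmodM ler_pM ?cmod_ge0.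
Qed.

Lemma CB_cst (a : Cplx R) : CB ((fun=> a) : X -> Cplx R).
Proof. by split=> [x|]; [exact: cvg_cst|exists (cmod a)]. Qed.

Lemma CBZ (a : Cplx R) f : CB f -> CB (a *: f).
Proof. by move=> Cf; have := CBM (CB_cst a) Cf. Qed.

Lemma coz_open f : continuous f -> open (coz f).
Proof.
move=> /continuousP cf; rewrite (_ : coz f = f @^-1` (~` [set 0])).
  apply: cf; apply: closed_openC; apply: accessible_closed_set1.
  exact/hausdorff_accessible/norm_hausdorff.
by apply/seteqP; split=> x /=; [move=> /eqP|move=> /eqP].
Qed.

Lemma cozP f x : ~ coz f x -> f x = 0.
Proof. by move=> /negP; rewrite negbK => /eqP. Qed.

Lemma supp0 : supp (0 : X -> Cplx R) = set0.
Proof.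
rewrite /supp (_ : coz _ = set0) ?closure0//.
by apply/seteqP; split=> // x; rewrite /coz /= eqxx.
Qed.

Lemma supp1 : supp (1 : X -> Cplx R) = [set: X].
Proof.
rewrite /supp (_ : coz _ = [set: X]) ?closureT//.
by apply/seteqP; split=> // x _; rewrite /coz /= oner_eq0.
Qed.

Lemma suppD f g : supp (f + g) `<=` supp f `|` supp g.
Proof.
rewrite /supp -closureU; apply: closureS => x /=.
apply: contraPP => /not_orP[/cozP fx /cozP gx].
by rewrite /coz /= /GRing.add /= fx gx addr0 eqxx.
Qed.

Lemma supp_sub f g : (forall x, f x = 0 -> g x = 0) -> supp g `<=` supp f.
Proof.
move=> fg; apply: closureS => x; apply: contraPP => /cozP/fg gx.
by rewrite /coz /= gx eqxx.
Qed.

Definition real_fun (u : X -> R) : X -> Cplx R :=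
  fun x => real_complex R (u x).

Lemma CB_real_fun (u : X -> R) (M : R) : continuous u ->
  (forall x, `|u x| <= M) -> CB (real_fun u).
Proof.
move=> cu uM; split=> [x|].
  by apply: continuous_comp; [exact: cu|exact: real_complex_continuous].
exists M => x; apply: le_trans (uM x).
by rewrite /cmod /= expr0n addr0 sqrtr_sqr.
Qed.

Lemma coz_real_fun (u : X -> R) : coz (real_fun u) = [set x | u x != 0].
Proof.
by apply/seteqP; split=> x; rewrite /coz /= eq_complex /= eqxx andbT.
Qed.

(** Truncation exhibits the strict superlevel sets of [u] as cozero-sets. *)
Lemma unit_cutoff (u : unit_functions R X) (a : R) :
  let f := real_fun (fun x => Num.max (set_val u x - a) 0) in
  0 <= a -> CB f /\ coz f = [set x | a < set_val u x].
Proof.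
move=> f a0; have cu := @unit_continuous R X u; split.
  apply: (CB_real_fun (M := 1)) => [x|x].
    apply: (@continuous_max _ _ (fun x => set_val u x - a) (fun=> 0)) => //.
      by apply: cvgB; [exact: cu|exact: cvg_cst].
    exact: cvg_cst.
  have /andP[u0 u1] := unit_bounds u x.
  rewrite ger0_norm ?le_max ?lexx ?orbT// ge_max ler01 andbT.
  by rewrite lerBlDr (le_trans u1)// lerDl.
rewrite coz_real_fun; apply/seteqP; split=> x /=.
  by apply: contraNT; rewrite -leNgt -subr_le0 => /max_idPr ->.
by move=> au; rewrite gt_eqF// lt_max subr_gt0 au.
Qed.

End FunctionSpaces.

(** * The ideal [C00P]: neighborhoods of supports, non-vanishing, units *)

Section NullSupports.
Variables (R : realType) (X : topologicalType) (P : topologicalType -> Prop).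
Hypothesis hP : topological_property P.
Hypothesis hclosed : closed_hereditary P.
Hypothesis hsums : preserved_finite_closed_sums P.
Local Notation C00PX := (@C00P R X P).

Lemma C00P_closed_neighborhood :
  C00PX = [set f | CB f /\ exists U, [/\ closed U, neighborhood (supp f) U & P U]].
Proof.
by apply/seteqP; split=> f [Cf /has_null_neighborhood_closedP nf]; split.
Qed.

(** A neighborhood with [P] may fail to be closed, and its closure may lose [P]; normality inserts a
    closed superlevel set of a Urysohn function between [supp f] and [U]. *)
Lemma C00P_neighborhood : normal_hausdorff X ->
  C00PX = [set f | CB f /\ exists U, neighborhood (supp f) U /\ P U].
Proof.
move=> [nX _]; rewrite C00P_closed_neighborhood; apply/seteqP; split=> f [Cf].
  by case=> U [_ fU PU]; split=> //; exists U.
case=> U [fU PU]; split=> //.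
have [u [u1 u0]] := normal_bump R nX (@closed_closure _ _) fU.
have cu := @unit_continuous R X u.
(* Any two levels strictly between 0 and 1 would do: [u] is 1 on [supp f], hence above 1/2 there,
   and 0 off [U], so that level 1/3 stays inside [U]. *)
have lt3 : 3^-1 < 2^-1 :> R by rewrite ltf_pV2 ?posrE// ltr_nat.
have := superlevel_null_neighborhood hP hclosed cu lt3 _ PU.
case=> [y|V hV nV].
  by apply: contraPP => /u0 uy /=; rewrite uy; apply/negP; rewrite -ltNge invr_gt0.
apply/has_null_neighborhood_closedP; exists V => //.
by apply: subset_trans hV => y /u1 /= ->; rewrite invf_le1 ?ler1n.
Qed.

Lemma C00P_ideal : is_ideal C00PX.
Proof.
split=> [f []//||f g [Cf nf] [Cg ng]|a f [Cf nf]|f h Cf [Ch nh]].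
- by split; [exact: CB0|rewrite supp0; exact: has_null_neighborhood0].
- split; first exact: CBD.
  apply: has_null_neighborhoodS (@suppD _ _ f g) _.
  exact: has_null_neighborhoodU.
- split; first exact: CBZ.
  apply: has_null_neighborhoodS nf; apply: supp_sub => x fx.
  by change (a * f x = 0); rewrite fx mulr0.
- split; split.
  + exact: CBM.
  + apply: has_null_neighborhoodS nh; apply: supp_sub => x hx.
    by change (f x * h x = 0); rewrite hx mulr0.
  + exact: CBM.
  + apply: has_null_neighborhoodS nh; apply: supp_sub => x hx.
    by change (h x * f x = 0); rewrite hx mul0r.
Qed.

(** The level 1/2 leaves room below the value 1 at [x]: cutting [u] off there still gives a function
    that is nonzero at [x]. *)
Lemma locally_prop_bump (x : X) :
  completely_regular_hausdorff X -> locally_prop P X ->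
  exists u : unit_functions R X, set_val u x = 1 /\
    has_null_neighborhood P [set y | 2^-1 <= set_val u y].
Proof.
move=> [crX _] lP; have [U xU PU] := lP x.
have [//|u [ux u0]] := completely_regular_bump R crX (x := x) (U := U).
  by apply: xU.
exists u; split=> //; have cu := @unit_continuous R X u.
have lt3 : 3^-1 < 2^-1 :> R by rewrite ltf_pV2 ?posrE// ltr_nat.
apply: (superlevel_null_neighborhood hP hclosed cu lt3 _ PU) => y.
by apply: contraPP => /u0 uy /=; rewrite uy; apply/negP; rewrite -ltNge invr_gt0.
Qed.

Lemma C00P_non_vanishing : completely_regular_hausdorff X ->
  (non_vanishing C00PX <-> locally_prop P X).
Proof.
move=> crX; split=> [nv x|lP x].
  (* The closure of a null neighborhood of [supp h] has [P] and is a neighborhood of [x]. *)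
  have [h [Ch [U hU nU]] hx] := nv x; exists (closure U) => // _ ->.
  by apply: (interiorS (@subset_closure _ U)); apply/hU/subset_closure.
have [u [ux nu]] := locally_prop_bump x crX lP.
have h0 : 0 <= 2^-1 :> R by rewrite invr_ge0.
have [Cf cf] := unit_cutoff u h0.
eexists; first split; first exact: Cf.
  apply: has_null_neighborhoodS nu; rewrite /supp cf.
  have cu := @unit_continuous R X u.
  rewrite [X in _ `<=` X](closure_id _).1; last exact: closed_superlevel.
  by apply: closureS => y /ltW.
have : coz (real_fun (fun x => Num.max (set_val u x - 2^-1) 0)) x.
  by rewrite cf /= ux invf_lt1 ?ltr1n.
by [].
Qed.

Lemma C00P_one : C00PX 1 <-> P X.
Proof.
split=> [[_]|PX]; first by rewrite supp1 => /has_null_neighborhoodT; exact.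
by split; [exact: CB_cst|rewrite supp1; apply/has_null_neighborhoodT].
Qed.

Lemma C00P_unital : completely_regular_hausdorff X -> locally_prop P X ->
  (unital C00PX <-> P X).
Proof.
move=> crX lP; split=> [[u Cu uh]|PX].
  (* A unit [u] must be 1 wherever some [h] of the ideal is nonzero, which is everywhere by
     non-vanishing. *)
  suff u1 : u = 1 by apply/C00P_one; rewrite -u1.
  apply/funext => x.
  have [h /uh[+ _] hx] := (C00P_non_vanishing crX).2 lP x.
  move=> /(congr1 (fun f => f x)) /= uhx; apply: (mulIf hx).
  by rewrite mul1r.
by exists 1 => [|h _]; [apply/C00P_one|rewrite mul1r mulr1].
Qed.

End NullSupports.

(** * The space lambda_P X inside the Stone-Cech compactification *)

Section ContinuousCombinations.
Variables (R : realType) (T : topologicalType).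

Lemma continuous_affine (F : T -> R) (a b : R) : continuous F ->
  continuous (fun t => F t * a - b).
Proof.
move=> cF t; apply: cvgB; last exact: cvg_cst.
by apply: cvgM; [exact: cF|exact: cvg_cst].
Qed.

Lemma continuous_complex (F G : T -> R) : continuous F -> continuous G ->
  continuous (fun t => real_complex R (F t) +
    (Complex 0 1 : Cplx R) * real_complex R (G t) : Cplx R).
Proof.
move=> cF cG t; apply: cvgD.
  by apply: continuous_comp; [exact: cF|exact: real_complex_continuous].
apply: cvgM; first exact: cvg_cst.
by apply: continuous_comp; [exact: cG|exact: real_complex_continuous].
Qed.

End ContinuousCombinations.

(** * Extending bounded functions to the Stone-Cech compactification *)

Section StoneCechExtension.
Variables (R : realType) (X : topologicalType).
Local Notation e := (@to_stone_cech R X).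

(** A coordinate of the cube, restricted to the compactification, is the continuous extension of
    [u]. *)
Definition stone_cech_coord (u : unit_functions R X) (p : stone_cech R X) : R :=
  (set_val p : cube R X) u.

Lemma stone_cech_coord_continuous u : continuous (stone_cech_coord u).
Proof.
move=> p U /(@cube_proj_continuous _ _ u (set_val p) _).
exact: (@stone_cech_val_continuous R X p).
Qed.

Lemma stone_cech_coordE (u : unit_functions R X) x :
  stone_cech_coord u (e x) = (set_val u : X -> R) x.
Proof. by []. Qed.

(** A bump at [x] extends to a coordinate, and the set where this coordinate is positive serves as
    [V]. *)
Lemma to_stone_cech_nbhs (x : X) (U : set X) : completely_regular_space X ->
  nbhs x U -> exists V, [/\ open V, V (e x) & e @^-1` V `<=` U].
Proof.
move=> crX nU; have [u [ux u0]] := completely_regular_bump R crX nU.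
exists [set p | 0 < stone_cech_coord u p]; split.
- exact/open_superlevel/stone_cech_coord_continuous.
- by rewrite /= stone_cech_coordE ux.
- by move=> y; apply: contraPP => /u0 uy /=; rewrite stone_cech_coordE uy ltxx.
Qed.

Lemma to_stone_cech_inj : completely_regular_hausdorff X -> injective e.
Proof.
move=> [crX hX] x y exy; apply: hX => U V nU nV; exists y.
split; last exact: nbhs_singleton.
have [W [_ Wx WU]] := to_stone_cech_nbhs crX nU.
by apply: WU; rewrite /= -exy.
Qed.

Lemma closure_to_stone_cech (C : set X) : completely_regular_space X ->
  e @^-1` closure (e @` C) `<=` closure C.
Proof.
move=> crX x clx U nU; have [V [oV Vx VU]] := to_stone_cech_nbhs crX nU.
have [_ [[y Cy <-] Vy]] := clx _ (open_nbhs_nbhs (conj oV Vx)).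
by exists y; split=> //; exact: VU.
Qed.

(** The cube only records functions into the unit interval, so [[-N, N]] is mapped affinely onto it
    and back. *)
Lemma stone_cech_bounded_extension (r : X -> R) (M : R) : continuous r ->
  (forall x, `|r x| <= M) ->
  exists2 F : stone_cech R X -> R, continuous F & forall x, F (e x) = r x.
Proof.
(* Adding 1 keeps the divisor [N + N] nonzero when [M] is 0; the absolute value covers a negative
   [M], possible when [X] is empty. *)
move=> cr rM0; pose N := `|M| + 1.
have N0 : 0 < N by rewrite ltr_wpDl.
have NN : N + N != 0 by rewrite gt_eqF// addr_gt0.
have rN x : - N <= r x <= N.
  by rewrite -ler_norml (le_trans (rM0 x))// (le_trans (ler_norm M))// lerDl.
have [||F cF Fe] := @stone_cech_extension R X (fun x => (r x + N) / (N + N)).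
- move=> x; apply: cvgM; last exact: cvg_cst.
  by apply: cvgD; [exact: cr|exact: cvg_cst].
- move=> x; have /andP[? ?] := rN x; apply/andP; split.
    apply: divr_ge0; last by rewrite addr_ge0 ?ltW.
    by rewrite -lerBlDr sub0r.
  by rewrite (ler_pdivrMr _ _ (addr_gt0 N0 N0)) mul1r lerD2r.
exists (fun p => F p * (N + N) - N) => [|x].
  exact: continuous_affine.
have -> : F (e x) = (r x + N) / (N + N) by rewrite -[LHS]/((F \o e) x) Fe.
by rewrite divfK// addrK.
Qed.

Lemma stone_cech_complex_extension (f : X -> Cplx R) : CB f ->
  exists F : stone_cech R X -> Cplx R,
    continuous F /\ forall x, F (e x) = f x.
Proof.
move=> [cf [M fM]].
have [||F cF Fe] := @stone_cech_bounded_extension (fun x => complex.Re (f x)) M.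
- by move=> x; apply: continuous_comp; [exact: cf|exact: Re_continuous].
- by move=> x; exact: le_trans (ler_Re_cmod _) (fM x).
have [||G cG Ge] := @stone_cech_bounded_extension (fun x => complex.Im (f x)) M.
- by move=> x; apply: continuous_comp; [exact: cf|exact: Im_continuous].
- by move=> x; exact: le_trans (ler_Im_cmod _) (fM x).
exists (fun p => real_complex R (F p) + (Complex 0 1) * real_complex R (G p)).
split=> [|x]; last by rewrite Fe Ge [RHS]complexE.
exact: continuous_complex.
Qed.

End StoneCechExtension.

(** * Openness, traces of compact sets and local compactness of [lambda] *)

Section Lambda.
Variables (R : realType) (X : topologicalType) (P : topologicalType -> Prop).
Hypothesis hP : topological_property P.
Hypothesis hclosed : closed_hereditary P.
Hypothesis hsums : preserved_finite_closed_sums P.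
Local Notation e := (@to_stone_cech R X).
Local Notation lambdaX := (@lambda R X P).
Local Notation Y := (lambda_space R X P).

Lemma lambda_open : open lambdaX.
Proof. by apply: bigcup_open => C _; exact: open_interior. Qed.

(** With [C] the cozero-set where [u > a], the open set where the coordinate exceeds [a] lies, by
    density of [X], in the closure of the image of [C], hence in the interior of that closure. *)
Lemma superlevel_sub_lambda (u : unit_functions R X) (a : R) : 0 <= a ->
  has_null_neighborhood P [set x | a <= (set_val u : X -> R) x] ->
  [set p | a < stone_cech_coord u p] `<=` lambdaX.
Proof.
move=> a0 nu; have [Cf cf] := unit_cutoff u a0.
pose C := [set x | a < (set_val u : X -> R) x].
have oa := open_superlevel a (@stone_cech_coord_continuous _ _ u).
suff aC : [set p | a < stone_cech_coord u p] `<=` closure (e @` C).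
  move=> p ap; exists C.
    split.
      exists (real_fun (fun x => Num.max ((set_val u : X -> R) x - a) 0)) => //.
      by case: Cf.
    apply: has_null_neighborhoodS nu.
    rewrite [X in _ `<=` X](closure_id _).1; last first.
      exact/closed_superlevel/unit_continuous.
    by apply: closureS => x /ltW.
  by move: aC; rewrite open_subsetE//; apply.
apply: subset_trans (dense_inter_closure (@to_stone_cech_dense R X) oa) _.
by apply: closureS => p [/= au [x _ xt]]; exists x => //; move: au; rewrite -xt.
Qed.

Lemma to_stone_cech_lambda x : completely_regular_hausdorff X ->
  locally_prop P X -> lambdaX (e x).
Proof.
move=> crX lP; have [u [ux nu]] := locally_prop_bump R hP hclosed x crX lP.
apply: (superlevel_sub_lambda _ nu); first by rewrite invr_ge0.
by rewrite /= stone_cech_coordE ux invf_lt1 ?ltr1n.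
Qed.

Lemma compact_lambda_null (K : set (stone_cech R X)) :
  completely_regular_space X -> compact K -> K `<=` lambdaX ->
  has_null_neighborhood P (e @^-1` K).
Proof.
move=> crX cK KL.
pose Q A := has_null_neighborhood P (e @^-1` A).
apply: (compact_ind (Q := Q)) cK; rewrite /Q.
- by rewrite preimage_set0; exact: has_null_neighborhood0.
- by move=> A B AB; apply: has_null_neighborhoodS => x; exact: AB.
- by move=> A B; rewrite preimage_setU; exact: has_null_neighborhoodU.
(* The closure of the image of [C] is a neighborhood of [p], and its trace on [X] lies in
   [closure C], which has a null neighborhood. *)
- move=> p /KL[C [_ nC] pC]; exists (closure (e @` C)) => //.
  apply: has_null_neighborhoodS nC; exact: closure_to_stone_cech.
Qed.

(** At the points of [X] where [F] is nonzero, the Urysohn function [u] equals 1. By density its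
    extension is at least 1 on all of [supp F], which [superlevel_sub_lambda] then places in
    [lambda]. *)
Lemma supp_extension_lambda (f : X -> Cplx R) (F : stone_cech R X -> Cplx R) :
  normal_space X -> C00P P f -> continuous F -> (forall x, F (e x) = f x) ->
  supp F `<=` lambdaX.
Proof.
move=> nX [Cf [U fU nU]] cF Fe.
have fcU : supp f `<=` (closure U)°.
  by apply: subset_trans fU _; apply: interiorS; exact: subset_closure.
have [u [u1 u0]] := normal_bump R nX (@closed_closure _ _) fcU.
have nu : has_null_neighborhood P [set x | 2^-1 <= (set_val u : X -> R) x].
  have lt3 : 3^-1 < 2^-1 :> R by rewrite ltf_pV2 ?posrE// ltr_nat.
  apply: (superlevel_null_neighborhood hP hclosed (@unit_continuous R X u) lt3 _ nU) => y.
  by apply: contraPP => /u0 uy /=; rewrite uy; apply/negP; rewrite -ltNge invr_gt0.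
have h0 : 0 <= 2^-1 :> R by rewrite invr_ge0.
apply: subset_trans (superlevel_sub_lambda h0 nu).
apply: (@subset_trans _ [set p | 1 <= stone_cech_coord u p]); last first.
  by move=> p /=; apply: lt_le_trans; rewrite invf_lt1 ?ltr1n.
have c1 := closed_superlevel (a := 1) (@stone_cech_coord_continuous _ _ u).
rewrite [X in _ `<=` X](closure_id _).1//; apply: closureS.
apply: subset_trans (dense_inter_closure (@to_stone_cech_dense R X) (coz_open cF)) _.
rewrite [X in _ `<=` X](closure_id _).1//; apply: closureS.
move=> p [+ [x _ xp]]; rewrite -xp /coz /= Fe stone_cech_coordE => fx.
by rewrite u1//; apply: subset_closure.
Qed.

(** In a compact Hausdorff space, regularity gives each point of the open set [lambda] a closed,
    hence compact, neighborhood inside it. *)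
Lemma lambda_locally_compact_hausdorff : locally_compact_hausdorff Y.
Proof.
split; last exact/set_type_hausdorff/stone_cech_hausdorff.
move=> y _; have nL : nbhs (set_val y : stone_cech R X) lambdaX.
  by apply: open_nbhs_nbhs; split; [exact: lambda_open|exact: set_valP].
have [V nV VL] := compact_regular (@stone_cech_hausdorff R X)
  (@stone_cech_compact R X) (@filterT _ _ _) nL.
exists (set_val @^-1` closure V).
  apply: (@filterS _ (nbhs y) _ (set_val @^-1` V)).
    by move=> z Vz _; exact: subset_closure.
  exact: subspace_val_continuous.
split.
  apply: compact_subspace VL.
  by apply: subclosed_compact (@stone_cech_compact R X) _ => //; exact: closed_closure.
apply: preimage_closed_continuous; last exact: closed_closure.
exact: subspace_val_continuous.
Qed.

(** * The dense embedding of [X] into [lambda] *)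

Section Embedding.
Hypothesis crX : completely_regular_hausdorff X.
Hypothesis lP : locally_prop P X.

Definition to_lambda (x : X) : Y :=
  SigSub (mem_set (to_stone_cech_lambda x crX lP)).

Lemma to_lambdaE x : set_val (to_lambda x) = e x.
Proof. by []. Qed.

Lemma to_lambda_continuous : continuous to_lambda.
Proof.
by apply: continuous_into_subspace; exact: (@to_stone_cech_continuous R X).
Qed.

Lemma to_lambda_embedding : topological_embedding to_lambda.
Proof.
split=> [x y /(congr1 set_val) exy|U]; first exact: (to_stone_cech_inj crX exy).
split=> [oU|[V oV <-]]; last first.
  by move/continuousP: to_lambda_continuous; exact.
(* The largest open set of the compactification whose trace on [X] lies in [U]. *)
pose W := \bigcup_(V in [set V : set (stone_cech R X) | open V /\ e @^-1` V `<=` U]) V.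
exists (set_val @^-1` W).
  by exists W => //; apply: bigcup_open => V [].
apply/seteqP; split=> x; first by case=> V [_ VU] Vx; exact: VU.
move=> Ux; have [V [oV Vx VU]] := to_stone_cech_nbhs R crX.1 (open_nbhs_nbhs (conj oU Ux)).
by exists V.
Qed.

Lemma to_lambda_dense : dense (range to_lambda).
Proof.
move=> _ /[swap] -[W oW <-] [y Wy].
have [|p [[Wp Lp] [x _ xp]]] :=
  @to_stone_cech_dense R X (W `&` lambdaX) _ (openI oW lambda_open).
  by exists (set_val y); split=> //; exact: set_valP.
exists (to_lambda x); split; last by exists x.
by rewrite /= to_lambdaE xp.
Qed.

(** The support of [g] has compact image in the compactification; the trace of this image on [X] has
    a null neighborhood and contains the support of the restriction. *)
Lemma C00_lambda_restriction (g : Y -> Cplx R) : C00 g -> C00P P (g \o to_lambda).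
Proof.
move=> [[cg [M gM]] sg]; split.
  split=> [x|]; last by exists M => x; exact: gM.
  by apply: continuous_comp; [exact: to_lambda_continuous|exact: cg].
have cK := compact_image (@subspace_val_continuous _ lambdaX) sg.
have KL : set_val @` supp g `<=` lambdaX by move=> _ [y _ <-]; exact: set_valP.
apply: has_null_neighborhoodS (compact_lambda_null crX.1 cK KL) => x sx.
exists (to_lambda x) => //.
suff : supp (g \o to_lambda) `<=` to_lambda @^-1` supp g by apply.
rewrite [X in _ `<=` X](closure_id _).1; last first.
  apply: preimage_closed_continuous; first exact: to_lambda_continuous.
  exact: closed_closure.
by apply: closureS => z gz; exact: subset_closure.
Qed.

(** The modulus of [g] nowhere exceeds its supremum over [X], since the open set where it does would
    meet the dense image of [X]. *)
Lemma supnorm_lambda (g : Y -> Cplx R) : CB g ->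
  supnorm g = supnorm (g \o to_lambda).
Proof.
move=> [cg [M gM]].
have cu : continuous (fun y => cmod (g y)).
  by move=> y; apply: continuous_comp; [exact: cg|exact: cmod_continuous].
pose A := range (fun y => cmod (g y)).
pose B := range (fun x => cmod (g (to_lambda x))).
change (sup A = sup B).
have BA : B `<=` A by move=> _ [x _ <-]; exists (to_lambda x).
have ubA : has_ubound A by exists M => _ [y _ <-]; exact: gM.
have ubB : has_ubound B by case: ubA => N NA; exists N => b /BA/NA.
(* If [Y] is empty, both ranges are empty, so the two suprema are taken over the same set. *)
have [[a Aa]|nA] := pselect (A !=set0); last first.
  by congr sup; apply/seteqP; split=> // a Aa; case: nA; exists a.
have Bn : B !=set0.
  case: Aa => y _ _; have [|z [_ [x _ _]]] := to_lambda_dense (O := setT) _ openT.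
    by exists y.
  by exists (cmod (g (to_lambda x))); exists x.
apply/eqP; rewrite eq_le; apply/andP; split; last first.
  by apply: ge_sup => // b /BA Ab; exact: ub_le_sup.
apply: ge_sup; first by exists a.
move=> _ [y _ <-]; rewrite leNgt; apply/negP => sy.
have [|z [/= + [x _ xz]]] :=
  to_lambda_dense (O := [set y | sup B < cmod (g y)]) _ (open_superlevel _ cu).
  by exists y.
by rewrite -xz ltNge => /negP; apply; apply: ub_le_sup => //; exists x.
Qed.

Lemma lambda_compactP : P X <-> compact_hausdorff Y.
Proof.
split=> [PX|[cY _]].
  split; last by case: lambda_locally_compact_hausdorff.
  (* Under [P X] the whole space is an admissible cozero-set, and the closure of its image is the
     entire compactification. *)
  have LT : lambdaX = [set: _].
    apply/seteqP; split=> // p _; exists [set: X].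
      split; last by rewrite closureT; apply/has_null_neighborhoodT.
      exists 1; first by case: (CB_cst X (1 : Cplx R)).
      by apply/seteqP; split=> // x _; rewrite /coz /= oner_eq0.
    have := dense_inter_closure (@to_stone_cech_dense R X) openT.
    by rewrite setTI open_subsetE; [apply|exact: openT].
  have := compact_subspace (A := lambdaX) (@stone_cech_compact R X).
  by rewrite preimage_setT; apply; rewrite LT.
(* The constant 1 lies in [C00] of the compact space [Y], so its restriction, again 1, lies in
   [C00P]. *)
apply/(C00P_one R X hP).
apply: (C00_lambda_restriction (g := fun=> 1)); split; first exact: CB_cst.
by apply: subclosed_compact cY _ => //; exact: closed_closure.
Qed.

End Embedding.
End Lambda.

(** * Characters of C_00(Y) *)

Section CompactSupports.
Variables (R : realType) (Y : topologicalType).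
Implicit Types f g h : Y -> Cplx R.

Lemma continuous_compact_supp_CB f : continuous f -> compact (supp f) -> CB f.
Proof.
move=> cf cK; split=> //.
have cu : continuous (fun y => cmod (f y)).
  by move=> y; apply: continuous_comp; [exact: cf|exact: cmod_continuous].
have [M M0 fM] := pinfty_ex_gt0 (compact_bounded (compact_image cu cK)).
exists M => y; have [fy|/cozP ->] := pselect (coz f y); last first.
  by rewrite cmod0 ltW.
apply: le_trans (ler_norm _) (fM _ _).
by exists y => //; exact: subset_closure.
Qed.

Lemma C00_sub f g : C00 f -> CB g -> (forall y, f y = 0 -> g y = 0) -> C00 g.
Proof.
move=> [Cf cf] Cg /supp_sub fg; split=> //.
by apply: subclosed_compact fg => //; exact: closed_closure.
Qed.

Lemma C00_0 : C00 (0 : Y -> Cplx R).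
Proof. by split; [exact: CB0|rewrite supp0; exact: compact0]. Qed.

Lemma C00D f g : C00 f -> C00 g -> C00 (f + g).
Proof.
move=> [Cf cf] [Cg cg]; split; first exact: CBD.
apply: subclosed_compact (@suppD _ _ f g); first exact: closed_closure.
exact: compactU.
Qed.

Lemma C00M f h : CB f -> C00 h -> C00 (f * h).
Proof.
move=> Cf Ch; apply: C00_sub (Ch) _ _; first by apply: CBM => //; case: Ch.
by move=> y hy; change (f y * h y = 0); rewrite hy mulr0.
Qed.

Lemma C00Z (a : Cplx R) f : C00 f -> C00 (a *: f).
Proof. by move=> Cf; have := C00M (@CB_cst R Y a) Cf. Qed.

Lemma C00_conj f : C00 f -> C00 (fun y => (f y)^* ).
Proof.
move=> Cf; have [[cf [M fM]] _] := Cf; apply: C00_sub (Cf) _ _; last first.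
  by move=> y ->; rewrite conjC0.
split=> [y|].
  by apply: continuous_comp; [exact: cf|exact: conj_continuous].
exists M => y; apply: le_trans (fM y).
by rewrite -lecR -!cmodE norm_conjC.
Qed.

Lemma locally_compact_nbhs (y : Y) : locally_compact [set: Y] ->
  exists2 K, nbhs y K & compact K /\ closed K.
Proof.
move=> /(_ y I) [K nK cK]; exists K => //.
by apply: (@filterS _ (nbhs y) _ _ _ _ nK) => z; exact.
Qed.

(** A bump vanishing off the intersection of [U] with a compact closed neighborhood [K] has its
    support in [K]. *)
Lemma C00_bump (y : Y) (U : set Y) : locally_compact_hausdorff Y -> nbhs y U ->
  exists f, [/\ C00 f, f y = 1 & coz f `<=` U].
Proof.
move=> [lY hY] nU; have [K nK [cK clK]] := locally_compact_nbhs y lY.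
have crY := locally_compact_completely_regular (R := R) lY hY.
have [u [uy u0]] := completely_regular_bump R crY (filterI nK nU).
have uKU : coz (real_fun (set_val u)) `<=` K `&` U.
  by rewrite coz_real_fun => z; apply: contraPP => /u0 /= ->; rewrite eqxx.
exists (real_fun (set_val u)); split.
- split.
    apply: (CB_real_fun (M := 1)) => [|z]; first exact: unit_continuous.
    by have /andP[u0' u1] := unit_bounds u z; rewrite ger0_norm.
  apply: subclosed_compact cK _; first exact: closed_closure.
  by rewrite (closure_id K).1 //; apply: closureS => z /uKU[].
- by rewrite /real_fun uy.
- by move=> z /uKU[].
Qed.

End CompactSupports.

(** * Nonzero characters are point evaluations *)

Section Characters.
Variables (R : realType) (Y : topologicalType).
Variable chi : (Y -> Cplx R) -> Cplx R.
Implicit Types f g h : Y -> Cplx R.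
Hypothesis lcY : locally_compact_hausdorff Y.
Hypothesis chiD : forall f g, C00 f -> C00 g -> chi (f + g) = chi f + chi g.
Hypothesis chiZ : forall (a : Cplx R) f, C00 f -> chi (a *: f) = a * chi f.
Hypothesis chiM : forall f g, C00 f -> C00 g -> chi (f * g) = chi f * chi g.

Lemma character0 : chi 0 = 0.
Proof. by have := chiZ 0 (@C00_0 R Y); rewrite scale0r mul0r. Qed.

(* Squared moduli of elements of the kernel lie in the kernel, and being
   nonnegative they do not cancel when added. *)
Lemma character_kernel_nonvanishing (K : set Y) : compact K ->
  (forall y, K y -> exists g, [/\ C00 g, chi g = 0 & g y != 0]) ->
  exists h, [/\ C00 h, chi h = 0 & forall y, K y -> h y != 0].
Proof.
move=> cK kerK.
pose Q (A : set Y) := exists h, [/\ C00 h, chi h = 0, forall y, 0 <= h y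
  & forall y, A y -> h y != 0].
suff [h [Ch h0 _ hK]] : Q K by exists h.
apply: compact_ind cK.
- by exists 0; split=> //; [exact: C00_0|exact: character0].
- by move=> A B AB [h [Ch h0 hp hB]]; exists h; split=> // y /AB/hB.
- move=> A B [h [Ch h0 hp hA]] [k [Ck k0 kp kB]]; exists (h + k); split.
  + exact: C00D.
  + by rewrite chiD// h0 k0 addr0.
  + by move=> y; apply: addr_ge0.
  + move=> y ABy; change (h y + k y != 0); rewrite paddr_eq0//.
    by rewrite negb_and; case: ABy => [/hA ->|/kB ->]//; rewrite orbT.
- move=> y /kerK[g [Cg g0 gy]]; exists (coz g).
    apply: open_nbhs_nbhs; split=> //; apply: coz_open.
    by case: Cg => -[].
  have Cj := C00_conj Cg.
  exists (g * (fun z => (g z)^* )); split.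
  + by apply: C00M => //; case: Cg.
  + by rewrite chiM// g0 mul0r.
  + by move=> z; exact: mul_conjC_ge0.
  + by move=> z gz; change (g z * (g z)^* != 0); rewrite mul_conjC_eq0.
Qed.

(** The quotient [f / h] is continuous at points of [supp f], where [h] is nonzero, and it vanishes
    on the open complement of [supp f], whatever zeros [h] has there. *)
Lemma C00_divisible f h : C00 f -> C00 h -> (forall y, supp f y -> h y != 0) ->
  exists2 q, C00 q & q * h = f.
Proof.
move=> Cf [[ch _] _] hf; have [[cf _] sf] := Cf.
pose q y := f y / h y.
have q0 y : f y = 0 -> q y = 0 by rewrite /q => ->; rewrite mul0r.
have cq : continuous q.
  move=> y; have [Ky|nKy] := pselect (supp f y).
    by apply: cvgM; [exact: cf|apply: cvgV; [exact: hf|exact: ch]].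
  apply: (near_cst_continuous 0).
  have : nbhs y (~` supp f).
    by apply: open_nbhs_nbhs; split=> //; exact/closed_openC/closed_closure.
  apply: filterS => z nKz; apply/q0/cozP => fz; apply: nKz.
  exact: subset_closure.
exists q; last first.
  apply/funext => y; change (f y / h y * h y = f y).
  have [fy|/cozP ->] := pselect (coz f y); last by rewrite !mul0r.
  by rewrite divfK// hf//; exact: subset_closure.
apply: C00_sub (Cf) _ (q0).
apply: continuous_compact_supp_CB => //.
by apply: subclosed_compact (supp_sub q0) => //; exact: closed_closure.
Qed.

Lemma character_evaluation : (exists2 f, C00 f & chi f != 0) ->
  exists y, forall f, C00 f -> chi f = f y.
Proof.
move=> [f Cf chif].
have [y kery] : exists y, forall g, C00 g -> chi g = 0 -> g y = 0.
  apply: contrapT => /forallNP nker.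
  have [||h [Ch h0 hK]] := @character_kernel_nonvanishing (supp f).
  - by case: Cf.
  - move=> y _; have /existsNP[g /not_implyP[Cg /not_implyP[g0 gy]]] := nker y.
    by exists g; split=> //; exact/eqP.
  - have [q Cq qh] := C00_divisible Cf Ch hK.
    by move/eqP: chif; apply; rewrite -qh chiM// h0 mulr0.
(* Since [chi e = 1], the function [g - chi g *: e] lies in the kernel and vanishes at [y]; so
   evaluation at [y] is [chi] times the factor [e y]. *)
pose e := (chi f)^-1 *: f.
have Ce : C00 e by exact: C00Z.
have chie : chi e = 1 by rewrite chiZ// mulVf.
have ev g : C00 g -> g y = chi g * e y.
  move=> Cg; have := kery (g + (- chi g) *: e).
  have Cge : C00 ((- chi g) *: e) by exact: C00Z.
  move=> /(_ (C00D Cg Cge)); rewrite chiD// chiZ// chie mulr1 subrr => /(_ erefl).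
  by change (g y + - chi g * e y = 0 -> g y = chi g * e y); rewrite mulNr => /subr0_eq.
exists y => g Cg; rewrite ev//.
(* A function with value 1 at [y] excludes [e y = 0]; then [e * e] shows that [e y] is idempotent,
   hence 1. *)
have [k [Ck ky _]] := C00_bump R lcY (@filterT _ (nbhs y) _).
have e0 : e y != 0.
  by apply: contra_eqN ky => /eqP e0; rewrite ev// e0 mulr0 eq_sym oner_eq0.
have : e y * e y = 1 * e y.
  have Cee : C00 (e * e) by apply: C00M => //; case: Ce.
  by have := ev _ Cee; rewrite chiM// chie mulr1.
by move/(mulIf e0) ->; rewrite mulr1.
Qed.

End Characters.

(** * Recovering the space from the algebra [C00] *)

Section Uniqueness.
Variables (R : realType) (X : topologicalType) (H : set (X -> Cplx R)).
Hypothesis idH : is_ideal H.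

(** The algebraic clauses of [isometrically_isomorphic], with the map exposed so that two
    isomorphisms out of the same [H] can be compared. *)
Definition algebra_isomorphism (Y : topologicalType) (K : set (Y -> Cplx R))
    (phi : (X -> Cplx R) -> (Y -> Cplx R)) :=
  [/\ set_bij H K phi,
      forall f g, H f -> H g -> phi (f + g) = phi f + phi g,
      forall (a : Cplx R) f, H f -> phi (a *: f) = a *: phi f
    & forall f g, H f -> H g -> phi (f * g) = phi f * phi g].

(* [f |-> phi f y] is a character of [C00 Z], read through [psi]. *)
Lemma algebra_isomorphism_point (Y Z : topologicalType)
    (phi : (X -> Cplx R) -> (Y -> Cplx R)) (psi : (X -> Cplx R) -> (Z -> Cplx R)) :
  locally_compact_hausdorff Y -> locally_compact_hausdorff Z ->
  algebra_isomorphism (@C00 R Y) phi -> algebra_isomorphism (@C00 R Z) psi ->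
  forall y, exists z, forall f, H f -> phi f y = psi f z.
Proof.
move=> lcY lcZ [[phiH _ phiS] phiD phiZ phiM] [[psiH psiI psiS] psiD psiZ psiM] y.
have [_ _ HD HZ HM] := idH.
have HMM f g : H f -> H g -> H (f * g).
  by move=> Hf Hg; have [/(_ _ Hf) Cf _ _ _ _] := idH; have [] := HM f g Cf Hg.
(* A set-theoretic inverse of [psi]; by surjectivity the default 0 is never resorted to on [C00]. *)
pose inv g := xget 0 [set f | H f /\ psi f = g].
have invP g : C00 g -> H (inv g) /\ psi (inv g) = g.
  by move=> /psiS[f Hf fg]; exact: (@xgetPex _ 0 [set f | H f /\ psi f = g]
    (ex_intro _ f (conj Hf fg))).
have invE f g : C00 g -> H f -> psi f = g -> inv g = f.
  move=> Cg Hf fg; have [Hi ig] := invP g Cg.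
  by apply: psiI; rewrite ?inE// ig.
have [||||z zP] := character_evaluation (chi := fun g => phi (inv g) y) lcZ.
- move=> f g Cf Cg; have [Hf ff] := invP f Cf; have [Hg gg] := invP g Cg.
  rewrite (invE (inv f + inv g)) ?phiD//; [exact: C00D|exact: HD|].
  by rewrite psiD// ff gg.
- move=> a f Cf; have [Hf ff] := invP f Cf.
  rewrite (invE (a *: inv f)) ?phiZ//; [exact: C00Z|exact: HZ|].
  by rewrite psiZ// ff.
- move=> f g Cf Cg; have [Hf ff] := invP f Cf; have [Hg gg] := invP g Cg.
  rewrite (invE (inv f * inv g)) ?phiM//; [|exact: HMM|].
    by apply: C00M => //; case: Cf.
  by rewrite psiM// ff gg.
(* The character is nonzero: a bump at [y] has a preimage [f] under [phi], and the character takes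
   the value 1 at [psi f]. *)
- have [k [Ck ky _]] := C00_bump R lcY (@filterT _ (nbhs y) _).
  have [f Hf fk] := phiS _ Ck; exists (psi f); first exact: psiH.
  by rewrite (invE f)//; [rewrite fk ky oner_eq0|exact: psiH].
- by exists z => f Hf; rewrite -zP ?(invE f)//; exact: psiH.
Qed.

(** A bump at [z] inside a neighborhood [U] takes the value 1 at [w] too, so [w] lies in every
    neighborhood of [z]. *)
Lemma C00_separates (Z : topologicalType) (z w : Z) :
  locally_compact_hausdorff Z ->
  (forall g : Z -> Cplx R, C00 g -> g z = g w) -> z = w.
Proof.
move=> lcZ zw; apply: lcZ.2 => U V nU nV; exists w.
split; last exact: nbhs_singleton.
have [k [Ck kz kU]] := C00_bump R lcZ nU.
by apply: kU; rewrite /coz /= -zw// kz oner_eq0.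
Qed.

(** When [psi f] is a bump at [s y] inside [U], the cozero-set of [phi f] is an open neighborhood of
    [y] that [s] maps into [U]. *)
Lemma point_map_continuous (Y Z : topologicalType)
    (phi : (X -> Cplx R) -> (Y -> Cplx R)) (psi : (X -> Cplx R) -> (Z -> Cplx R))
    (s : Y -> Z) : locally_compact_hausdorff Z ->
  algebra_isomorphism (@C00 R Y) phi -> algebra_isomorphism (@C00 R Z) psi ->
  (forall y f, H f -> phi f y = psi f (s y)) -> continuous s.
Proof.
move=> lcZ [[phiH _ _] _ _ _] [[_ _ psiS] _ _ _] sP y U nU.
have [k [/psiS[f Hf <-] kz kU]] := C00_bump R lcZ nU.
have [[cf _] _] := phiH _ Hf.
have : nbhs y (coz (phi f)).
  apply: open_nbhs_nbhs; split; first exact: coz_open.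
  by rewrite /coz /= sP// kz oner_eq0.
by apply: filterS => x; rewrite /coz /= sP//; exact: kU.
Qed.

Lemma algebra_isomorphism_homeomorphic (Y Z : topologicalType)
    (phi : (X -> Cplx R) -> (Y -> Cplx R)) (psi : (X -> Cplx R) -> (Z -> Cplx R)) :
  locally_compact_hausdorff Y -> locally_compact_hausdorff Z ->
  algebra_isomorphism (@C00 R Y) phi -> algebra_isomorphism (@C00 R Z) psi ->
  homeomorphic Y Z.
Proof.
move=> lcY lcZ iphi ipsi.
have [s sP] := choice (algebra_isomorphism_point lcY lcZ iphi ipsi).
have [t tP] := choice (algebra_isomorphism_point lcZ lcY ipsi iphi).
exists s, t; split.
- exact: point_map_continuous lcZ iphi ipsi sP.
- exact: point_map_continuous lcY ipsi iphi tP.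
(* No [phi f] distinguishes [t (s y)] from [y], and these functions exhaust [C00]. *)
- move=> y; apply: C00_separates => // g; have [[_ _ phiS] _ _ _] := iphi.
  by move=> /phiS[f Hf <-]; rewrite -tP// -sP.
- move=> z; apply: C00_separates => // g; have [[_ _ psiS] _ _ _] := ipsi.
  by move=> /psiS[f Hf <-]; rewrite -sP// -tP.
Qed.

End Uniqueness.

(** * The isometric isomorphism from [C00P] onto [C00] of [lambda] *)

Section LambdaIsomorphism.
Variables (R : realType) (X : topologicalType) (P : topologicalType -> Prop).
Hypothesis hP : topological_property P.
Hypothesis hclosed : closed_hereditary P.
Hypothesis hsums : preserved_finite_closed_sums P.
Hypothesis nX : normal_hausdorff X.
Hypothesis lP : locally_prop P X.
Local Notation Y := (lambda_space R X P).
Let crX := normal_completely_regular_hausdorff R nX.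
Let j : X -> Y := to_lambda R hP hclosed crX lP.

(** Cutting the extension over the compactification down to [Y] preserves compactness of the
    support, since the whole support already lies in [Y]. *)
Lemma lambda_extension (f : X -> Cplx R) : C00P P f ->
  exists g : Y -> Cplx R, C00 g /\ g \o j = f.
Proof.
move=> Cf; have [F [cF Fe]] := stone_cech_complex_extension Cf.1.
have sF := supp_extension_lambda hP hclosed nX.1 Cf cF Fe.
have cv : continuous (set_val : Y -> stone_cech R X).
  exact: subspace_val_continuous.
exists (F \o set_val); split; last by apply/funext => x; exact: Fe.
have cg : continuous (F \o set_val : Y -> Cplx R).
  by move=> y; apply: continuous_comp; [exact: cv|exact: cF].
have sg : compact (supp (F \o set_val : Y -> Cplx R)).
  have cK : compact (supp F).
    by apply: subclosed_compact (@stone_cech_compact R X) _ => //; exact: closed_closure.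
  apply: subclosed_compact (compact_subspace cK sF) _; first exact: closed_closure.
  have cS : closed (set_val @^-1` supp F : set Y).
    by apply: preimage_closed_continuous cv _; exact: closed_closure.
  rewrite [X in _ `<=` X](closure_id _).1//; apply: closureS => y Fy.
  exact: subset_closure.
by split=> //; exact: continuous_compact_supp_CB.
Qed.

Lemma lambda_eq (g h : Y -> Cplx R) : continuous g -> continuous h ->
  g \o j = h \o j -> g = h.
Proof.
move=> cg ch gh; have hC : hausdorff_space (Cplx R) by exact: norm_hausdorff.
have ghj y : range j y -> g y = h y.
  by case=> x _ <-; exact: (congr1 (fun f => f x) gh).
exact: (@dense_eq Y (Cplx R) g h (range j) hC
  (to_lambda_dense hP hclosed crX lP) cg ch ghj).
Qed.

Lemma lambda_isomorphism : exists phi : (X -> Cplx R) -> (Y -> Cplx R),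
  algebra_isomorphism (@C00P R X P) (@C00 R Y) phi /\
  forall f, C00P P f -> supnorm (phi f) = supnorm f.
Proof.
(* Each [f] goes to its extension, unique by density; uniqueness yields the algebra laws, because
   operations commute with restriction. The default 0 is taken only outside [C00P]. *)
pose phi f : Y -> Cplx R := xget 0 [set g | C00 g /\ g \o j = f].
have phiP f : C00P P f -> C00 (phi f) /\ phi f \o j = f.
  by move=> /lambda_extension[g gf];
    exact: (@xgetPex _ 0 [set g | C00 g /\ g \o j = f] (ex_intro _ g gf)).
have phiE f g : C00P P f -> C00 g -> g \o j = f -> phi f = g.
  move=> /phiP[[[cf _] _] fj] [[cg _] _] gj.
  by apply: lambda_eq => //; rewrite fj gj.
have [HCB _ HD HZ HM] := C00P_ideal R X hP hsums.
exists phi; split; last first.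
  move=> f /phiP[[Cf _] fj].
  by rewrite (supnorm_lambda hP hclosed crX lP Cf); congr supnorm.
split=> [|f g Hf Hg|a f Hf|f g Hf Hg].
- split=> [f /phiP[]//|f g|g Cg].
    by rewrite !inE => /phiP[_ {2}<-] /phiP[_ {2}<-] ->.
  have Hg := C00_lambda_restriction hP hclosed hsums crX lP Cg.
  by exists (g \o j) => //; exact: phiE.
- have [Cf fj] := phiP f Hf; have [Cg gj] := phiP g Hg.
  apply: phiE; [exact: HD|exact: C00D|].
  by rewrite -[in RHS]fj -[in RHS]gj.
- have [Cf fj] := phiP f Hf.
  apply: phiE; [exact: HZ|exact: C00Z|].
  by rewrite -[in RHS]fj.
- have [Cf fj] := phiP f Hf; have [Cg gj] := phiP g Hg.
  apply: phiE; [by have [] := HM f g Hf.1 Hg|by apply: C00M => //; case: Cf|].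
  by rewrite -[in RHS]fj -[in RHS]gj.
Qed.

End LambdaIsomorphism.

Theorem theorem3p3p8 (R : realType) (X : topologicalType)
    (P : topologicalType -> Prop)
    (hP : topological_property P)
    (hclosed : closed_hereditary P)
    (hsums : preserved_finite_closed_sums P) :
  C00P P =
    [set f : X -> Cplx R | CB f /\
      exists U : set X, [/\ closed U, neighborhood (supp f) U & P U]] /\
  (normal_hausdorff X ->
    C00P P =
      [set f : X -> Cplx R | CB f /\
        exists U : set X, neighborhood (supp f) U /\ P U]) /\
  is_ideal (@C00P R X P) /\
  (completely_regular_hausdorff X ->
    (non_vanishing (@C00P R X P) <-> locally_prop P X)) /\
  (completely_regular_hausdorff X -> locally_prop P X ->
    (unital (@C00P R X P) <-> P X)) /\
  (normal_hausdorff X -> locally_prop P X ->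
    let Y := lambda_space R X P in
    [/\ is_ideal (@C00P R X P),
        locally_compact_hausdorff Y,
        isometrically_isomorphic
          (@C00P R X P) (@C00 R Y),
        forall Z : topologicalType, locally_compact_hausdorff Z ->
          isometrically_isomorphic
            (@C00P R X P) (@C00 R Z) ->
          homeomorphic Z Y
      & (exists j : X -> Y,
           [/\ forall x, set_val (j x) = to_stone_cech R x,
               topological_embedding j & dense (range j)]) /\
        (unital (@C00P R X P) <-> P X) /\
        (P X <-> compact_hausdorff Y)]).
Proof.
have idH := C00P_ideal R X hP hsums.
split; first exact: C00P_closed_neighborhood.
split; first exact: C00P_neighborhood.
split; first exact: idH.
split; first exact: C00P_non_vanishing.
split; first exact: C00P_unital.
move=> nX lP Y; have crX := normal_completely_regular_hausdorff R nX.
have lcY : locally_compact_hausdorff Y := lambda_locally_compact_hausdorff R X P.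
have [phi [iphi phi_norm]] := lambda_isomorphism R hP hclosed hsums nX lP.
split=> //.
- by exists phi; have [? ? ? ?] := iphi; split.
(* Both [Z] and [Y] receive an algebra isomorphism from the same ideal, so their points can be
   matched through it. *)
- move=> Z lcZ [psi [bpsi psiD psiZ psiM _]].
  by apply: (algebra_isomorphism_homeomorphic idH lcZ lcY (And4 bpsi psiD psiZ psiM) iphi).
- split; last by split; [exact: C00P_unital|exact: lambda_compactP].
  exists (to_lambda R hP hclosed crX lP); split=> //.
    exact: to_lambda_embedding.
  exact: to_lambda_dense.
Qed.
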